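(* Let $\mathcal{H}$ be a separable complex Hilbert space, $(\Omega,\mu)$ a measure space with positive measure $\mu$, $K\in\mathcal{B}(\mathcal{H})$, and let $(\mathcal{X},\mathcal{Y})$ be a continuous biframe for $\mathcal{H}$ with respect to $(\Omega,\mu)$, with continuous biframe operator $S_{\mathcal{X},\mathcal{Y}}$. Let $A>0$. Then $(\mathcal{X},\mathcal{Y})$ is a continuous $K$-biframe for $\mathcal{H}$ with bounds $A$ and $B$ for some $B$ with $A\le B<\infty$ if and only if $S_{\mathcal{X},\mathcal{Y}}\ge A\,KK^{*}$.
   Context: $\mathcal{B}(\mathcal{H})$ denotes the bounded linear operators on $\mathcal{H}$. A mapping $\mathcal{X}:\Omega\to\mathcal{H}$ is weakly measurable if $\omega\mapsto\langle f,\mathcal{X}(\omega)\rangle$ is measurable for every $f\in\mathcal{H}$. For $K\in\mathcal{B}(\mathcal{H})$, a pair $(\mathcal{X},\mathcal{Y})$ of mappings $\Omega\to\mathcal{H}$ is a continuous $K$-biframe for $\mathcal{H}$ with respect to $(\Omega,\mu)$ with bounds $A$ and $B$, where $0<A\le B<\infty$, if $\mathcal{X},\mathcal{Y}$ are weakly measurable and for all $f\in\mathcal{H}$ the following integral exists and $A\|K^{*}f\|^{2}\le\int_{\Omega}\langle f,\mathcal{X}(\omega)\rangle\langle\mathcal{Y}(\omega),f\rangle\,d\mu\le B\|f\|^{2}$. A continuous biframe is a pair that is a continuous $I$-biframe for some bounds, where $I$ is the identity operator of $\mathcal{H}$. The continuous biframe operator is $S_{\mathcal{X},\mathcal{Y}}f=\int_{\Omega}\langle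 f,\mathcal{X}(\omega)\rangle\mathcal{Y}(\omega)\,d\mu$, understood weakly: $\langle S_{\mathcal{X},\mathcal{Y}}f,g\rangle=\int_{\Omega}\langle f,\mathcal{X}(\omega)\rangle\langle\mathcal{Y}(\omega),g\rangle\,d\mu$ for all $f,g\in\mathcal{H}$. For operators, $S\ge R$ means $\langle Sf,f\rangle\ge\langle Rf,f\rangle$ for all $f\in\mathcal{H}$. *)

(* Defs.v *)
From HB Require Import structures.
From mathcomp Require Import all_boot all_order all_algebra sesquilinear.
From mathcomp Require Import all_classical all_reals all_analysis.
From mathcomp Require Import complex.

Set Implicit Arguments.
Unset Strict Implicit.
Unset Printing Implicit Defensive.

Import Order.TTheory GRing.Theory Num.Theory numFieldNormedType.Exports.

Local Open Scope classical_set_scope.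
Local Open Scope complex_scope.
Local Open Scope ring_scope.

Definition separable_space (T : topologicalType) : Prop :=
  exists D : set T, countable D /\ dense D.

(* With [H : completeNormedModType R[i]], [induces_norm ip] makes H a complex
   Hilbert space.  A [{dot H for Num.conj}] form is linear in its first argument
   and conjugate-linear in its second.  The norm of H is R[i]-valued. *)
Definition induces_norm (R : realType) (H : normedModType R[i])
    (ip : {dot H for Num.conj}) : Prop :=
  forall x : H, `|x| ^+ 2 = ip x x.

Section ComplexIntegral.
Context (d : measure_display) (T : measurableType d) (R : realType).
Implicit Types (mu : {measure set T -> \bar R}) (h : T -> R[i]).

(* Borel measurability into R[i], identified with R * R. *)
Definition cmeasurable h : Prop :=
  measurable_fun [set: T] (fun w => complex.Re (h w)) /\
  measurable_fun [set: T] (fun w => complex.Im (h w)).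

Definition cintegrable mu h : Prop :=
  mu.-integrable [set: T] (fun w => (complex.Re (h w))%:E) /\
  mu.-integrable [set: T] (fun w => (complex.Im (h w))%:E).

Definition cintegral mu h : R[i] :=
  (\int[mu]_w complex.Re (h w)) +i* (\int[mu]_w complex.Im (h w)).

End ComplexIntegral.

Section Operators.
Context (R : realType) (H : completeNormedModType R[i]).
Context (ip : {dot H for Num.conj}).

(* For K linear and bounded on a Hilbert space, the vector selected by [xget]
   exists and is unique (Riesz representation). *)
Definition adjoint (K : H -> H) (f : H) : H :=
  xget 0 [set h : H | forall g : H, ip (K g) f = ip g h].

(* The order of R[i] is the partial one: [x <= y] says that [y - x] is a
   nonnegative real. *)
Definition operator_ge (S T : H -> H) : Prop :=
  forall f : H, ip (T f) f <= ip (S f) f.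

End Operators.

Section Biframes.
Context (R : realType) (H : completeNormedModType R[i]).
Context (ip : {dot H for Num.conj}).
Context (d : measure_display) (Omega : measurableType d).
Context (mu : {measure set Omega -> \bar R}).

Definition weakly_measurable (X : Omega -> H) : Prop :=
  forall f : H, cmeasurable (fun w => ip f (X w)).

Definition continuous_K_biframe (K : H -> H) (X Y : Omega -> H) (A B : R)
    : Prop :=
  [/\ 0 < A, A <= B, weakly_measurable X, weakly_measurable Y &
    forall f : H,
      let q := fun w => ip f (X w) * ip (Y w) f in
      [/\ cintegrable mu q,
          A%:C * `|adjoint ip K f| ^+ 2 <= cintegral mu q &
          cintegral mu q <= B%:C * `|f| ^+ 2]].

Definition continuous_biframe (X Y : Omega -> H) : Prop :=
  exists A B : R, continuous_K_biframe idfun X Y A B.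

(* Weak (Pettis) integral of [ip f (X w) *: Y w]; the vector selected by [xget]
   exists and is unique when (X, Y) is a continuous biframe of a Hilbert space. *)
Definition biframe_operator (X Y : Omega -> H) (f : H) : H :=
  xget 0 [set h : H | forall g : H,
    let q := fun w => ip f (X w) * ip (Y w) g in
    cintegrable mu q /\ ip h g = cintegral mu q].

End Biframes.

(* Main.v *)
(* Positivity of the biframe integral [Q f f] lets polarization extend [Q] to an
   everywhere defined positive semidefinite sesquilinear form.  By Cauchy-Schwarz
   and the upper bound [B], [Q] is bounded, so Riesz representation yields
   [<S f, g> = Q f g].  With [<K K^* f, f> = |K^* f|^2], the operator inequality
   is then the lower [K]-biframe bound; the upper bound comes for free from the
   biframe hypothesis. *)
Require Import Defs.
From HB Require Import structures.
From mathcomp Require Import all_boot all_order all_algebra sesquilinear.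
From mathcomp Require Import all_classical all_reals all_analysis.
From mathcomp Require Import complex.
From mathcomp Require Import ring lra.

Set Implicit Arguments.
Unset Strict Implicit.
Unset Printing Implicit Defensive.

Import Order.TTheory GRing.Theory Num.Theory numFieldNormedType.Exports.

Local Open Scope classical_set_scope.
Local Open Scope complex_scope.
Local Open Scope ring_scope.

(** For [c] nonzero, evaluate at the minimizer [- b / c]; for [c = 0], a nonnegative affine function
    has zero slope. *)
Lemma discriminant_le (R : realFieldType) (a b c : R) : 0 <= c ->
  (forall t, 0 <= a + t * (2 * b) + t ^+ 2 * c) -> b ^+ 2 <= a * c.
Proof.
move=> c0 h; have [cE|cN0] := eqVneq c 0; last first.
  have := h (- b / c).
  have -> : a + - b / c * (2 * b) + (- b / c) ^+ 2 * c = (a * c - b ^+ 2) / c.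
    by field.
  by rewrite pmulr_lge0 ?subr_ge0 // invr_gt0 lt_def cN0.
have [->|bN0] := eqVneq b 0; first by rewrite cE; lra.
(* At this point the affine function takes the value -1. *)
have := h (- (a + 1) / (2 * b)).
by rewrite cE mulr0 divfK ?mulf_neq0 ?pnatr_eq0 //; lra.
Qed.

(** * Polarization and Cauchy-Schwarz for sesquilinear forms *)

Section SesquilinearForms.
Context (R : realType) (V : lmodType R[i]).

Definition is_sesquilinear (Q : V -> V -> R[i]) : Prop :=
  (forall a u v w, Q (a *: u + v) w = a * Q u w + Q v w) /\
  (forall a u v w, Q w (a *: u + v) = a^*%C * Q w u + Q w v).

Implicit Types Q : V -> V -> R[i].

Lemma dot_sesquilinear (ip : {dot V for Num.conj}) : is_sesquilinear ip.
Proof.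
split=> a u v w; first by rewrite (linearPl ip w a u v).
by rewrite (linearPr ip w a u v).
Qed.

Lemma sesquilinear_diag Q a u v : is_sesquilinear Q ->
  Q (a *: v + u) (a *: v + u) =
  a * a^*%C * Q v v + a * Q v u + a^*%C * Q u v + Q u u.
Proof. by move=> [Ql Qr]; rewrite Ql !Qr; ring. Qed.

Lemma polarization Q u v : is_sesquilinear Q ->
  4%:R * Q u v =
    Q (1 *: v + u) (1 *: v + u) - Q (-1 *: v + u) (-1 *: v + u)
    + 'i * (Q ('i *: v + u) ('i *: v + u) - Q (- 'i *: v + u) (- 'i *: v + u)).
Proof.
move=> Qs; rewrite !sesquilinear_diag //.
(* Splitting into real components lets [ring] verify an identity that relies on ['i ^+ 2 = -1]. *)
case: (Q v v) (Q v u) (Q u v) (Q u u) => [a1 b1] [a2 b2] [a3 b3] [a4 b4].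
have -> : (4%:R : R[i]) = (4%:R : R)%:C by rewrite rmorph_nat.
by apply/eqP; rewrite eq_complex /=; apply/andP; split; apply/eqP; ring.
Qed.

Section Semidefinite.
Context (Q : V -> V -> R[i]).
Hypotheses (Qs : is_sesquilinear Q) (Q_ge0 : forall u, 0 <= Q u u).

Let Re_ge0 u : 0 <= complex.Re (Q u u).
Proof. by have := Q_ge0 u; rewrite lecE /= => /andP[]. Qed.

Let Im0 u : complex.Im (Q u u) = 0.
Proof. exact: ger0_Im. Qed.

(** Symmetry comes from positivity alone: the value of the form at ['i *: v + u] is real, and its
    imaginary part is the difference of the two sides. *)
Lemma semidefinite_Re_sym u v : complex.Re (Q u v) = complex.Re (Q v u).
Proof.
have := Im0 ('i *: v + u); rewrite sesquilinear_diag //.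
have := Im0 u; have := Im0 v.
case: (Q v v) (Q v u) (Q u v) (Q u u) => [a1 b1] [a2 b2] [a3 b3] [a4 b4] /=.
by move=> -> ->; lra.
Qed.

Lemma semidefinite_expand (t : R) u v :
  complex.Re (Q (t%:C *: v + u) (t%:C *: v + u)) =
  complex.Re (Q u u) + t * (2 * complex.Re (Q u v))
  + t ^+ 2 * complex.Re (Q v v).
Proof.
have := semidefinite_Re_sym u v; rewrite sesquilinear_diag //.
case: (Q v v) (Q v u) (Q u v) (Q u u) => [a1 b1] [a2 b2] [a3 b3] [a4 b4] /=.
by move=> ->; ring.
Qed.

(** Real multiples of [v] give a nonnegative real quadratic in [t]. Bounding the real part is enough
    for the Riesz theorem below. *)
Lemma semidefinite_CauchySchwarz u v :
  complex.Re (Q u v) ^+ 2 <= complex.Re (Q u u) * complex.Re (Q v v).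
Proof. by apply: discriminant_le => // t; rewrite -semidefinite_expand. Qed.

End Semidefinite.
End SesquilinearForms.

(** * Riesz representation in a complex Hilbert space *)

Section Riesz.
Context (R : realType) (H : completeNormedModType R[i]).
Context (ip : {dot H for Num.conj}) (ip_norm : induces_norm ip).

Let sqn (x : H) : R := complex.Re (ip x x).

(** Restates completeness through the real-valued [sqn], because the norm of [H] takes values in
    [R[i]], where the order is partial. *)
Lemma dot_complete (u : nat -> H) :
  (forall e : R, 0 < e -> \forall n \near \oo,
     forall i j, (n <= i)%N -> (n <= j)%N -> sqn (u i - u j) < e) ->
  exists h, forall e : R, 0 < e -> \forall n \near \oo, sqn (u n - h) < e.
Proof.
have sqnE x : (sqn x)%:C = `|x| ^+ 2.
  by rewrite ip_norm RRe_real // ger0_real // dnorm_ge0.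
have lt_sqn (e : R[i]) x : 0 < e -> (sqn x < complex.Re e ^+ 2) = (`|x| < e).
  move=> e0; rewrite -ltcR rmorphXn /= (RRe_real (gtr0_real e0)) sqnE.
  by rewrite ltr_pXn2r ?nnegrE // ltW.
have Re_gt0 (e : R[i]) : 0 < e -> 0 < complex.Re e.
  by rewrite ltcE => /andP[].
move=> u_cauchy.
have : cvg (u @ \oo).
  apply/cauchy_cvgP/cauchy_ballP => e e0.
  have [n _ /(_ n (leqnn n)) un] := u_cauchy _ (exprn_gt0 2 (Re_gt0 _ e0)).
  near_simpl; exists ([set i | (n <= i)%N], [set i | (n <= i)%N]).
    by split; exists n.
  by move=> [i j] [/= ni nj]; rewrite -ball_normE /= -lt_sqn // un.
move=> /cvg_ex[h uh]; exists h => e e0.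
have s0 : 0 < Num.sqrt e by rewrite sqrtr_gt0.
have s0C : 0 < (Num.sqrt e)%:C by rewrite ltcR.
move/cvgrPdistC_lt : uh => /(_ _ s0C); apply: filterS => n.
by rewrite -lt_sqn //= sqr_sqrtr // ltW.
Qed.

(* The representing vector minimizes [J x = |x|^2 - 2 Re (phi x)]; minimizing
   sequences are Cauchy by the parallelogram law. *)
Theorem Riesz_representation (phi : H -> R[i]) (M : R) :
  0 <= M ->
  (forall a u v, phi (a *: u + v) = a * phi u + phi v) ->
  (forall x, complex.Re (phi x) ^+ 2 <= M * complex.Re (ip x x)) ->
  exists h : H, forall x, phi x = ip x h.
Proof.
move=> M0 phi_lin phi_bound.
have ips := dot_sesquilinear ip; have ip0 := dnorm_ge0 ip.
have sqn_ge0 x : 0 <= sqn x by have := ip0 x; rewrite lecE => /andP[].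
pose J x := sqn x - 2 * complex.Re (phi x).
(* Otherwise [s + M < 2 * r], and squaring with [r ^+ 2 <= M * s] contradicts
   [0 <= (s - M) ^+ 2]. *)
have J_lb x : - M <= J x.
  have := phi_bound x; have := sqn_ge0 x; rewrite /J -/(sqn x).
  move: (sqn x) (complex.Re _) => s r s0 rs; rewrite leNgt; apply/negP => lt_sr.
  have sM0 : 0 <= s + M by rewrite addr_ge0.
  have lt2 : s + M < 2 * r by lra.
  have : (s + M) ^+ 2 < (2 * r) ^+ 2.
    by rewrite ltr_pXn2r ?nnegrE // (le_trans sM0) // ltW.
  have := sqr_ge0 (s - M); nra.
pose E := [set J x | x in [set: H]].
have E_lb : has_lbound E by exists (- M) => _ [x _ <-].
have E_inf : has_inf E by split => //; exists (J 0), 0.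
set m := inf E; have J_ge x : m <= J x by apply: ge_inf => //; exists x.
have J_expand (t : R) a x : J (t%:C *: x + a) =
    J a + t * (2 * (complex.Re (ip a x) - complex.Re (phi x))) + t ^+ 2 * sqn x.
  rewrite /J /sqn semidefinite_expand // phi_lin.
  by case: (phi x) (phi a) => [? ?] [? ?] /=; ring.
(* The quadratic [t |-> J (t x + a) - m] is nonnegative, so its discriminant shows that a
   near-minimizer [a] almost represents the real part of [phi]. *)
have slope a x : (complex.Re (ip a x) - complex.Re (phi x)) ^+ 2 <=
    (J a - m) * sqn x.
  apply: discriminant_le => // t.
  by have := J_ge (t%:C *: x + a); rewrite J_expand; lra.
(* Parallelogram law: compare [m] with [J] at the midpoint of [a] and [b], expanding from [b] along
   [a - b] with [t = 1/2] and [t = 1]. *)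
have sqnB_le a b : sqn (a - b) <= 2 * (J a - m) + 2 * (J b - m).
  have := J_ge (((2^-1 : R)%:C) *: (a - b) + b).
  rewrite J_expand.
  have := J_expand 1 b (a - b).
  rewrite scale1r subrK; lra.
have /choice[u uJ] : forall n : nat, exists x, J x < m + n.+1%:R^-1.
  move=> n; have /inf_adherent : 0 < n.+1%:R^-1 :> R by rewrite invr_gt0.
  by move=> /(_ _ E_inf)[_ [x _ <-] xm]; exists x.
have uJ_lt (e : R) : 0 < e ->
    \forall n \near \oo, forall i, (n <= i)%N -> J (u i) - m < e.
  move=> e0; have [n _ ne] := near_infty_natSinv_lt (PosNum e0).
  exists n => // k /= nk i ki; rewrite ltrBlDl; apply: (lt_trans (uJ i)).
  by rewrite ltrD2l; apply: ne; exact: leq_trans ki.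
have /dot_complete[h uh] : forall e : R, 0 < e -> \forall n \near \oo,
    forall i j, (n <= i)%N -> (n <= j)%N -> sqn (u i - u j) < e.
  move=> e e0; have e4 : 0 < e / 4 by rewrite divr_gt0.
  apply: filterS (uJ_lt _ e4) => n un i j ni nj.
  by have := sqnB_le (u i) (u j); have := un _ ni; have := un _ nj; lra.
have Re_phi x : complex.Re (phi x) = complex.Re (ip x h).
  rewrite (semidefinite_Re_sym ips ip0 x h); apply/eqP; rewrite -subr_eq0.
  rewrite -sqrf_eq0 eq_le sqr_ge0 andbT; apply/ler_addgt0Pl => e e0.
  (* Two errors of square at most [d * sqn x] combine to a square of at most [4 * d * sqn x <= e];
     the [+ 1] covers [sqn x = 0]. *)
  pose d := e / (4 * (sqn x + 1)).
  have d0 : 0 < d by rewrite divr_gt0 // mulr_gt0 // ltr_wpDl.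
  have [n [un1 un2]] := filter_ex (filterI (uJ_lt _ d0) (uh _ d0)).
  have {}un1 := un1 _ (leqnn n).
  have := slope (u n) x.
  have := semidefinite_CauchySchwarz ips ip0 (u n - h) x.
  rewrite -/(sqn x) -/(sqn (u n - h)).
  have -> : ip (u n - h) x = ip (u n) x - ip h x.
    by rewrite -(linearBl ip).
  have -> : complex.Re (ip (u n) x - ip h x) =
            complex.Re (ip (u n) x) - complex.Re (ip h x).
    by case: (ip (u n) x) (ip h x) => [? ?] [? ?].
  have de : d * (4 * (sqn x + 1)) = e.
    by rewrite divfK // gt_eqF // mulr_gt0 // ltr_wpDl.
  have h1 : (J (u n) - m) * sqn x <= d * sqn x by rewrite ler_wpM2r // ltW.
  have h2 : sqn (u n - h) * sqn x <= d * sqn x by rewrite ler_wpM2r // ltW.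
  have := sqn_ge0 x.
  move: (complex.Re _) (complex.Re (ip (u n) x)) (complex.Re (ip h x)).
  move=> p q r; have := sqr_ge0 (2 * q - p - r); nra.
exists h => x; apply/eqP; rewrite eq_complex Re_phi eqxx /=; apply/eqP.
(* The imaginary part at [x] is minus the real part at ['i *: x]. *)
have := Re_phi ('i *: x + 0); rewrite phi_lin (proj1 ips).
have -> : ip 0 h = 0 by rewrite (linear0l ip).
have -> : phi 0 = 0.
  by have := phi_lin (-1) 0 0; rewrite scaler0 addr0 mulN1r addNr.
by case: (phi x) (ip x h) => [? ?] [? ?] /=; lra.
Qed.

End Riesz.

(** * Linearity of the complex integral *)

Section ComplexIntegral.
Context (d : measure_display) (T : measurableType d) (R : realType).
Context (mu : {measure set T -> \bar R}).
Implicit Types h k : T -> R[i].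

Let integrable_lincomb (a b : R) (f g : T -> R) :
  mu.-integrable setT (EFin \o f) -> mu.-integrable setT (EFin \o g) ->
  mu.-integrable setT (EFin \o (fun w => a * f w + b * g w)).
Proof.
move=> fi gi; have := integrableD measurableT
  (integrableZl measurableT a fi) (integrableZl measurableT b gi).
by apply: eq_integrable => // w _; rewrite /= EFinD !EFinM.
Qed.

Let Rintegral_lincomb (a b : R) (f g : T -> R) :
  mu.-integrable setT (EFin \o f) -> mu.-integrable setT (EFin \o g) ->
  \int[mu]_w (a * f w + b * g w) = a * \int[mu]_w f w + b * \int[mu]_w g w.
Proof.
move=> fi gi; have scale c (p : T -> R) : mu.-integrable setT (EFin \o p) ->
    mu.-integrable setT (EFin \o (fun w => c * p w)).
  move=> /(integrableZl measurableT c).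
  by apply: eq_integrable => // w _; rewrite /= EFinM.
by rewrite RintegralD //; [rewrite !RintegralZl|exact: scale|exact: scale].
Qed.

(** The sum with a negated coefficient has the shape expected by the real linear-combination
    lemmas. *)
Lemma Re_scale (a z : R[i]) : complex.Re (a * z) =
  complex.Re a * complex.Re z + - complex.Im a * complex.Im z.
Proof. by case: a z => [? ?] [? ?] /=; rewrite mulNr. Qed.

Lemma Im_scale (a z : R[i]) : complex.Im (a * z) =
  complex.Im a * complex.Re z + complex.Re a * complex.Im z.
Proof. by case: a z => [? ?] [? ?] /=; rewrite addrC. Qed.

Lemma cintegrableZ (a : R[i]) h : cintegrable mu h ->
  cintegrable mu (fun w => a * h w).
Proof.
move=> [hr hi]; split.
  under eq_fun do rewrite Re_scale; exact: integrable_lincomb.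
under eq_fun do rewrite Im_scale; exact: integrable_lincomb.
Qed.

Lemma cintegralZ (a : R[i]) h : cintegrable mu h ->
  cintegral mu (fun w => a * h w) = a * cintegral mu h.
Proof.
move=> [hr hi]; apply/eqP; rewrite eq_complex Re_scale Im_scale /=.
apply/andP; split; apply/eqP.
  under eq_Rintegral do rewrite Re_scale; exact: Rintegral_lincomb.
under eq_Rintegral do rewrite Im_scale; exact: Rintegral_lincomb.
Qed.

Lemma cintegrableD h k : cintegrable mu h -> cintegrable mu k ->
  cintegrable mu (fun w => h w + k w).
Proof.
move=> [hr hi] [kr ki]; split.
  apply: eq_integrable (integrableD measurableT hr kr) => // w _.
  by case: (h w) (k w) => [? ?] [? ?].
apply: eq_integrable (integrableD measurableT hi ki) => // w _.
by case: (h w) (k w) => [? ?] [? ?].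
Qed.

Lemma cintegralD h k : cintegrable mu h -> cintegrable mu k ->
  cintegral mu (fun w => h w + k w) = cintegral mu h + cintegral mu k.
Proof.
move=> [hr hi] [kr ki]; apply/eqP; rewrite eq_complex /=.
apply/andP; split; apply/eqP; rewrite -RintegralD //.
  by apply: eq_Rintegral => w _; case: (h w) (k w) => [? ?] [? ?].
by apply: eq_Rintegral => w _; case: (h w) (k w) => [? ?] [? ?].
Qed.

End ComplexIntegral.

(** * Adjoints and the biframe operator *)

Section Operators.
Context (R : realType) (H : completeNormedModType R[i]).
Context (ip : {dot H for Num.conj}) (ip_norm : induces_norm ip).

Lemma dotC u v : ip u v = (ip v u)^*%C.
Proof. by rewrite (hermC ip) expr0 mul1r. Qed.

Lemma adjointP (K : {linear H -> H}) : bounded_near K (nbhs (0 : H)) ->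
  forall f g, ip (K g) f = ip g (adjoint ip K f).
Proof.
move=> /linear_boundedP /pinfty_ex_gt0[r r0 Kr] f.
suff [h hP] : exists h, forall g, ip (K g) f = ip g h.
  pose P := [set h : H | forall g : H, ip (K g) f = ip g h].
  exact: (@xgetPex _ 0 P (ex_intro _ h hP)).
have ips := dot_sesquilinear ip; have ip0 := dnorm_ge0 ip.
have sqn_ge0 x : 0 <= complex.Re (ip x x).
  by have := ip0 x; rewrite lecE => /andP[].
(* Cauchy-Schwarz and [|K x| <= r * |x|] give the constant [r ^+ 2 * |f| ^+ 2]; [r] lives in [R[i]],
   hence its real part. *)
apply: (Riesz_representation ip_norm
  (M := complex.Re r ^+ 2 * complex.Re (ip f f))).
- by rewrite mulr_ge0 ?sqr_ge0.
- by move=> a u v; rewrite linearP (proj1 ips).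
move=> x; apply: le_trans (semidefinite_CauchySchwarz ips ip0 (K x) f) _.
rewrite mulrAC ler_wpM2r // -lecR rmorphM rmorphXn /=.
rewrite (RRe_real (gtr0_real r0)) !RRe_real ?ger0_real //.
by rewrite -!ip_norm -exprMn ler_pXn2r ?nnegrE // mulr_ge0 // ltW.
Qed.

Context (d : measure_display) (Omega : measurableType d).
Context (mu : {measure set Omega -> \bar R}) (X Y : Omega -> H).

Let q f g w := ip f (X w) * ip (Y w) g.
Let Q f g := cintegral mu (q f g).

Let q_sesquilinear w : is_sesquilinear (fun f g => q f g w).
Proof.
have [ipl ipr] := dot_sesquilinear ip.
by split=> a u v z; rewrite /q ?ipl ?ipr; ring.
Qed.

(** Pointwise polarization makes [q f g] a combination of four diagonal integrands. Subtraction is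
    written as [-1 *] so that closure under scaling and addition suffices. *)
Lemma cintegrable_polarized : (forall f, cintegrable mu (q f f)) ->
  forall f g, cintegrable mu (q f g).
Proof.
move=> qi f g; have -> : q f g = (fun w => 4^-1 *
    (1 * q (1 *: g + f) (1 *: g + f) w + -1 * q (-1 *: g + f) (-1 *: g + f) w
     + 'i * (1 * q ('i *: g + f) ('i *: g + f) w
             + -1 * q (- 'i *: g + f) (- 'i *: g + f) w))).
  apply/funext => w; rewrite !mul1r !mulN1r.
  by rewrite -(polarization f g (q_sesquilinear w)) mulKf.
by do !(apply: cintegrableZ || apply: cintegrableD || apply: qi).
Qed.

Lemma cintegral_sesquilinear : (forall f g, cintegrable mu (q f g)) ->
  is_sesquilinear Q.
Proof.
move=> qi; split=> a u v w; rewrite /Q.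
  rewrite -cintegralZ // -cintegralD //; last exact: cintegrableZ.
  by congr cintegral; apply/funext => t; rewrite (proj1 (q_sesquilinear t)).
rewrite -cintegralZ // -cintegralD //; last exact: cintegrableZ.
by congr cintegral; apply/funext => t; rewrite (proj2 (q_sesquilinear t)).
Qed.

Lemma biframe_operatorP (B : R) : (forall f, cintegrable mu (q f f)) ->
  (forall f, 0 <= Q f f) -> (forall f, Q f f <= B%:C * `|f| ^+ 2) ->
  forall f g, ip (biframe_operator ip mu X Y f) g = Q f g.
Proof.
move=> qi Q0 QB f; have qi2 := cintegrable_polarized qi.
have Qs := cintegral_sesquilinear qi2.
have Re_Q0 g : 0 <= complex.Re (Q g g).
  by have := Q0 g; rewrite lecE => /andP[].
have Re_ip0 g : 0 <= complex.Re (ip g g).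
  by have := dnorm_ge0 ip g; rewrite lecE => /andP[].
(* [Q f] is conjugate-linear, so Riesz is applied to its conjugate. *)
suff [h hP] : exists h, forall g, (Q f g)^*%C = ip g h.
  pose P := [set h : H |
    forall g : H, cintegrable mu (q f g) /\ ip h g = Q f g].
  have Ph : P h by move=> g; split => //; rewrite dotC -hP conjcK.
  by move=> g; have [] := @xgetPex _ 0 P (ex_intro _ h Ph) g.
(* Cauchy-Schwarz for [Q] followed by the upper bound on [Q g g]; the absolute value keeps the
   constant nonnegative whatever the sign of [B]. *)
apply: (Riesz_representation ip_norm (M := complex.Re (Q f f) * `|B|)).
- by rewrite mulr_ge0.
- by move=> a u v; rewrite (proj2 Qs) rmorphD rmorphM /= conjcK.
move=> g.
have -> : complex.Re (Q f g)^*%C = complex.Re (Q f g) by case: (Q f g).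
apply: le_trans (semidefinite_CauchySchwarz Qs Q0 f g) _.
rewrite -mulrA ler_wpM2l //; apply: (@le_trans _ _ (B * complex.Re (ip g g))).
  have := QB g; rewrite ip_norm lecE => /andP[_].
  by rewrite Re_scale /= oppr0 mul0r addr0.
by rewrite ler_wpM2r // ler_norm.
Qed.

End Operators.

Theorem theorem3p7 (R : realType) (H : completeNormedModType R[i])
    (ip : {dot H for Num.conj}) (ip_norm : induces_norm ip)
    (H_separable : separable_space H)
    (d : measure_display) (Omega : measurableType d)
    (mu : {measure set Omega -> \bar R})
    (K : {linear H -> H}) (K_bounded : bounded_near K (nbhs (0 : H)))
    (X Y : Omega -> H) (XY_biframe : continuous_biframe ip mu X Y)
    (A : R) (A_gt0 : 0 < A) :
  (exists B : R, A <= B /\ continuous_K_biframe ip mu K X Y A B) <->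
  operator_ge ip (biframe_operator ip mu X Y)
    (fun f : H => A%:C *: K (adjoint ip K f)).
Proof.
have [A0 [B0 [A0_gt0 _ mX mY bounds]]] := XY_biframe.
have SP f g : ip (biframe_operator ip mu X Y f) g =
    cintegral mu (fun w => ip f (X w) * ip (Y w) g).
  apply: (biframe_operatorP ip_norm (B := B0)) => {f g} f.
  - by have [] := bounds f.
  (* The lower biframe bound is a positive multiple of a squared norm, which makes [Q] positive. *)
  - have [_ + _] := bounds f; apply: le_trans.
    by rewrite mulr_ge0 ?exprn_ge0 // ler0c ltW.
  - by have [] := bounds f.
have KK f : ip (A%:C *: K (adjoint ip K f)) f =
    A%:C * `|adjoint ip K f| ^+ 2.
  rewrite -[A%:C *: _]addr0 (proj1 (dot_sesquilinear ip)) (linear0l ip) addr0.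
  by rewrite adjointP // ip_norm.
split=> [[B [_ [_ _ _ _ K_bounds]]] f|S_ge].
  by rewrite KK SP; have [] := K_bounds f.
(* [B0] is an upper bound but may lie below [A]; the maximum also meets [A <= B]. *)
exists (Num.max A B0); split; first by rewrite le_max lexx.
split=> //; first by rewrite le_max lexx.
move=> f q; have [qi _ qB] := bounds f; split=> //.
  by have := S_ge f; rewrite KK SP.
apply: le_trans qB _; rewrite ler_wpM2r ?exprn_ge0 //.
by rewrite lecR le_max lexx orbT.
Qed.
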